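(* Let $v>0$ and $g>0$ be real numbers. For $\theta\in[0,\pi/2]$ let $L(\theta)$ denote the ground-to-ground arc length of the trajectory of an ideal projectile launched with initial speed $v$ at angle $\theta$ to the horizon under gravitational acceleration $g$, i.e. $$L(\theta)=\int_0^{\tau(\theta)}\sqrt{v^2\cos^2\theta+(v\sin\theta-gt)^2}\,dt,\qquad \tau(\theta)=\frac{2v\sin\theta}{g}.$$ Then $L$ attains its maximum over $[0,\pi/2]$ at exactly one angle $\theta^*$, and $\theta^*$ is the smallest positive root of the equation $$\csc(\theta)=\coth(\csc(\theta)).$$ Moreover, the function $\coth$ has a unique positive fixed point $\alpha$ (that is, a unique $\alpha>0$ with $\coth(\alpha)=\alpha$), and $\theta^*=\csc^{-1}(\alpha)$. Numerically, $\theta^*\approx 0.9855$ radians (rounded to four decimal places), i.e. $\theta^*\approx 56.47^\circ$ (rounded to two decimal places).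
   Context: An ideal projectile is the path of a point-mass traveling over a flat surface, experiencing constant downward acceleration $g>0$, with no resistance or propulsion. Launched from ground level with initial speed $v>0$ at angle $\theta$ to the horizon, it has position $(vt\cos\theta,\; vt\sin\theta-gt^2/2)$ at time $t$, and it hits the ground at time $\tau(\theta)=2v\sin(\theta)/g$. Its ground-to-ground arc length is the arc length of this path for $0\le t\le\tau(\theta)$, i.e. the integral of its speed over that time interval. Here $\csc\theta=1/\sin\theta$, $\coth x=\cosh x/\sinh x$, and, for $x\ge 1$, $\csc^{-1}(x)$ denotes the unique $\theta\in(0,\pi/2]$ with $\csc\theta=x$. *)

(* Defs.v *)
From Stdlib Require Export Reals.
From Stdlib Require Import Lra ClassicalEpsilon.
From Coquelicot Require Export Coquelicot.

Open Scope R_scope.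

Definition arc_length (x y : R -> R) (a b : R) : R :=
  RInt (fun t => sqrt (Derive x t ^ 2 + Derive y t ^ 2)) a b.

Definition pos_x (v theta t : R) : R := v * t * cos theta.
Definition pos_y (v g theta t : R) : R := v * t * sin theta - g * t ^ 2 / 2.

Definition tau (v g theta : R) : R := 2 * v * sin theta / g.

Definition L (v g theta : R) : R :=
  arc_length (pos_x v theta) (pos_y v g theta) 0 (tau v g theta).

Definition is_maximizer_on (f : R -> R) (a b x : R) : Prop :=
  a <= x <= b /\ forall y, a <= y <= b -> f y <= f x.

Definition csc (theta : R) : R := 1 / sin theta.
Definition coth (x : R) : R := cosh x / sinh x.

(* The condition [sin theta <> 0] restricts the equation to the domain of
   [csc], since division by zero is total here.  There [csc theta <> 0], so
   [coth (csc theta)] is a genuine value as well. *)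
Definition is_csc_coth_root (theta : R) : Prop :=
  sin theta <> 0 /\ csc theta = coth (csc theta).

(* Meaningful only for [1 <= x]; see [arccsc_spec]. *)
Definition arccsc (x : R) : R :=
  epsilon (inhabits 0) (fun theta => 0 < theta <= PI / 2 /\ csc theta = x).

Lemma arccsc_spec (x : R) (hx : 1 <= x) :
  unique (fun theta => 0 < theta <= PI / 2 /\ csc theta = x) (arccsc x).
Proof.
assert (hi : 0 < / x) by (apply Rinv_0_lt_compat; lra).
assert (hi1 : / x <= 1) by (rewrite <- Rinv_1; apply Rinv_le_contravar; lra).
assert (hP := PI_RGT_0).
assert (hex : exists theta, 0 < theta <= PI / 2 /\ csc theta = x).
{ exists (asin (/ x)).
  assert (hs : sin (asin (/ x)) = / x) by (apply sin_asin; lra).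
  assert (hb := asin_bound (/ x)).
  split.
  - split; [|lra].
    destruct (Rlt_le_dec 0 (asin (/ x))) as [h|h]; [exact h|exfalso].
    assert (h0 : sin (asin (/ x)) <= sin 0) by (apply sin_incr_1; lra).
    rewrite sin_0 in h0. lra.
  - unfold csc. rewrite hs. field. lra. }
assert (he := epsilon_spec (inhabits 0) _ hex). fold (arccsc x) in he.
split; [exact he|].
assert (h1 : forall u, 0 < u <= PI / 2 /\ csc u = x -> u = asin (/ x)).
{ intros u [hu hcu]. rewrite <- hcu. unfold csc, Rdiv.
  rewrite Rmult_1_l, Rinv_inv. symmetry. apply asin_sin. lra. }
intros t ht. rewrite (h1 _ he), (h1 _ ht). reflexivity.
Qed.

(* Main.v *)
(* With [s = sin theta], the arc length is [v^2/g * F s] where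
   [F s = s + (1 - s^2) artanh s], and [F' s = 2 (1 - s artanh s)].  Since
   [s artanh s] is increasing on [0, 1), [F] has a single critical point [s0],
   which is a strict maximum; the endpoint [s = 1] is compared directly through
   [F s0 = 1 / s0 > 1 = F 1].  Putting [x = 1/s], the equation [s artanh s = 1]
   becomes [tanh x = 1/x], i.e. [coth x = x].  The numerical claims follow from
   the signs of [s artanh s - 1] at two rationals enclosing [s0]. *)

Require Import Defs.
From Stdlib Require Import Reals Lra Factorial Machin.
From Coquelicot Require Import Coquelicot.
Open Scope R_scope.

(** * The inverse hyperbolic tangent and the fixed points of [coth] *)

Definition artanh (s : R) : R := (ln (1 + s) - ln (1 - s)) / 2.

Lemma artanh_lt (s t : R) : -1 < s -> s < t -> t < 1 -> artanh s < artanh t.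
Proof.
intros hs hst ht. unfold artanh.
assert (ln (1 + s) < ln (1 + t)) by (apply ln_increasing; lra).
assert (ln (1 - t) < ln (1 - s)) by (apply ln_increasing; lra).
lra.
Qed.

Lemma artanh_0 : artanh 0 = 0.
Proof. unfold artanh. rewrite Rplus_0_r, Rminus_0_r. lra. Qed.

Lemma artanh_inj (s t : R) :
  -1 < s < 1 -> -1 < t < 1 -> artanh s = artanh t -> s = t.
Proof.
intros hs ht e. destruct (Rtotal_order s t) as [h|[h|h]]; [|exact h|].
- assert (k := artanh_lt s t ltac:(lra) h ltac:(lra)). lra.
- assert (k := artanh_lt t s ltac:(lra) h ltac:(lra)). lra.
Qed.

Lemma tanh_bound (x : R) : -1 < tanh x < 1.
Proof.
unfold tanh, sinh, cosh.
assert (h1 := exp_pos x). assert (h2 := exp_pos (- x)).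
split; apply Rmult_lt_reg_r with (r := (exp x + exp (- x)) / 2); try lra;
  field_simplify; lra.
Qed.

Lemma artanh_tanh (x : R) : artanh (tanh x) = x.
Proof.
unfold artanh, tanh, sinh, cosh.
assert (h1 := exp_pos x). assert (h2 := exp_pos (- x)).
replace (1 + _) with (exp x / ((exp x + exp (- x)) / 2)) by (field; lra).
replace (1 - _) with (exp (- x) / ((exp x + exp (- x)) / 2)) by (field; lra).
rewrite !ln_div, !ln_exp by lra. lra.
Qed.

Lemma coth_inv_tanh (x : R) : coth x = / tanh x.
Proof. unfold coth, tanh. now rewrite Rinv_div. Qed.

(** With [s = / x], the equation reads [tanh x = s], and applying [artanh] gives [x = artanh s]. The
    bound [/ x < 1] keeps [s] where [artanh] is injective. *)
Lemma coth_fixed_artanh (x : R) :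
  0 < x -> (coth x = x <-> / x < 1 /\ / x * artanh (/ x) = 1).
Proof.
intros hx. assert (ht := tanh_bound x).
assert (hi := Rinv_0_lt_compat _ hx).
rewrite coth_inv_tanh. split.
- intros h. assert (e : / x = tanh x) by (rewrite <- h at 1; apply Rinv_inv).
  rewrite e at 1 3. rewrite artanh_tanh. split; [lra | field; lra].
- intros [h1 h2]. replace (tanh x) with (/ x); [apply Rinv_inv|].
  apply artanh_inj; [lra | exact ht |].
  rewrite artanh_tanh. apply Rmult_eq_reg_l with (/ x); [|lra].
  rewrite h2. field. lra.
Qed.

(** * The maximum of the normalized arc length *)

Lemma mult_artanh_lt (s t : R) :
  0 <= s -> s < t -> t < 1 -> s * artanh s < t * artanh t.
Proof.
intros hs hst ht.
assert (h := artanh_lt s t ltac:(lra) hst ht).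
assert (h0 : 0 <= artanh s).
{ destruct hs as [hs|<-]; [|rewrite artanh_0; lra].
  assert (k := artanh_lt 0 s ltac:(lra) hs ltac:(lra)).
  rewrite artanh_0 in k. lra. }
nra.
Qed.

(* The arc length, in units of [v^2 / g], as a function of [s = sin theta].
   At [s = 1] the junk value [ln 0] is multiplied by [0], so [F 1 = 1]. *)
Definition F (s : R) : R := s + (1 - s ^ 2) * artanh s.

Lemma F_1 : F 1 = 1.
Proof. unfold F. ring. Qed.

Lemma is_derive_F (s : R) :
  -1 < s < 1 -> is_derive F s (2 * (1 - s * artanh s)).
Proof.
intros hs. unfold F, artanh. auto_derive; [lra|]. unfold Rminus. field. lra.
Qed.

Lemma F_lt_max (s0 s : R) :
  0 < s0 < 1 -> s0 * artanh s0 = 1 -> 0 <= s <= 1 -> s <> s0 -> F s < F s0.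
Proof.
intros h0 he hs hne.
(* The mean value theorem below needs a derivative at both ends of the interval, and [is_derive_F]
   stops short of 1. *)
destruct (Req_dec s 1) as [->|h1].
- rewrite F_1. unfold F.
  replace (artanh s0) with (/ s0)
    by (apply Rmult_eq_reg_l with s0; [rewrite he; field|]; lra).
  replace (s0 + (1 - s0 ^ 2) * / s0) with (/ s0) by (field; lra).
  rewrite <- Rinv_1. apply Rinv_lt_contravar; lra.
- assert (hd : forall c, 0 <= c < 1 ->
    derivable_pt_lim F c (2 * (1 - c * artanh c))).
  { intros c hc. apply is_derive_Reals, is_derive_F. lra. }
  destruct (Rlt_le_dec s s0) as [h|h].
  + destruct (MVT_cor2 F (fun c => 2 * (1 - c * artanh c)) s s0 h) as [c [e hc]].
    { intros c hc. apply hd. lra. }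
    assert (k := mult_artanh_lt c s0 ltac:(lra) ltac:(lra) ltac:(lra)).
    simpl in e. nra.
  + destruct (MVT_cor2 F (fun c => 2 * (1 - c * artanh c)) s0 s ltac:(lra))
      as [c [e hc]].
    { intros c hc. apply hd. lra. }
    assert (k := mult_artanh_lt s0 c ltac:(lra) ltac:(lra) ltac:(lra)).
    simpl in e. nra.
Qed.

(** * Taylor bounds for [exp] and the enclosure of the critical point *)

Lemma is_derive_n_exp (n : nat) (x : R) : is_derive_n exp n x (exp x).
Proof.
revert x. induction n as [|n IH]; intros x; [reflexivity|].
simpl. apply is_derive_ext with exp; [|apply is_derive_exp].
intros t. symmetry. apply is_derive_n_unique, IH.
Qed.

(** Lagrange remainder at some [z] with [0 < z < x <= 1]; the factor 3 comes from
    [exp z < exp 1 <= 3]. *)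
Lemma exp_taylor_bounds (n : nat) (x : R) : 0 < x <= 1 ->
  let p := sum_f_R0 (fun m => x ^ m / INR (fact m)) n in
  p <= exp x <= p + 3 * (x ^ S n / INR (fact (S n))).
Proof.
intros hx p.
destruct (Taylor_Lagrange exp n 0 x) as [z [hz e]]; [lra| |].
{ intros t _ [|k] _; [exact I|]. exists (exp t). apply (is_derive_n_exp (S k)). }
rewrite (is_derive_n_unique _ _ _ _ (is_derive_n_exp (S n) z)), Rminus_0_r in e.
rewrite (sum_eq _ (fun m => x ^ m / INR (fact m))) in e.
2:{ intros i _. rewrite (is_derive_n_unique _ _ _ _ (is_derive_n_exp i 0)), exp_0.
    ring. }
fold p in e.
assert (hq : 0 < x ^ S n / INR (fact (S n))).
{ apply Rdiv_lt_0_compat; [apply pow_lt; lra | apply INR_fact_lt_0]. }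
assert (h1 := exp_pos z).
assert (h2 : exp z < exp 1) by (apply exp_increasing; lra).
assert (h3 := exp_le_3).
rewrite e. nra.
Qed.

(** The denominator 1680 is [7! / 3]. *)
Lemma exp_taylor_6 (x : R) : 0 < x <= 1 ->
  let p := 1 + x + x ^ 2 / 2 + x ^ 3 / 6 + x ^ 4 / 24 + x ^ 5 / 120 + x ^ 6 / 720 in
  p <= exp x <= p + x ^ 7 / 1680.
Proof.
intros hx p. assert (h := exp_taylor_bounds 6 x hx).
cbn [sum_f_R0] in h. rewrite !INR_IZR_INZ in h.
cbn -[pow] in h. unfold p. lra.
Qed.

Lemma exp_mult_4 (x : R) : exp (4 * x) = exp x ^ 4.
Proof.
replace (4 * x) with (x + x + x + x) by ring. rewrite !exp_plus. ring.
Qed.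

(* Below, [s artanh s < 1] is rewritten as [(1 + s) / (1 - s) < exp (1 / (2 s)) ^ 4],
   which keeps the argument of [exp] in the range of the Taylor bounds. *)
Lemma mult_artanh_lower : 0.833552 * artanh 0.833552 < 1.
Proof.
unfold artanh.
destruct (exp_taylor_6 (/ 2 / 0.833552)) as [h _]; [lra|].
assert (h2 : ln ((1 + 0.833552) / (1 - 0.833552)) < 4 * (/ 2 / 0.833552)).
{ rewrite <- (ln_exp (4 * _)). apply ln_increasing; [lra|].
  rewrite exp_mult_4.
  eapply Rlt_le_trans; [|apply pow_incr; split; [|exact h]];
    simpl; lra. }
rewrite ln_div in h2 by lra. lra.
Qed.

Lemma mult_artanh_upper : 1 < 0.83357 * artanh 0.83357.
Proof.
unfold artanh.
destruct (exp_taylor_6 (/ 2 / 0.83357)) as [_ h]; [lra|].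
assert (h2 : 4 * (/ 2 / 0.83357) < ln ((1 + 0.83357) / (1 - 0.83357))).
{ rewrite <- (ln_exp (4 * _)). apply ln_increasing; [apply exp_pos|].
  rewrite exp_mult_4.
  eapply Rle_lt_trans; [apply pow_incr; split; [left; apply exp_pos|exact h]|];
    simpl; lra. }
rewrite ln_div in h2 by lra. lra.
Qed.

(** * Closed form of the arc length integral *)

Definition speed (v g theta t : R) : R :=
  sqrt (v ^ 2 * cos theta ^ 2 + (v * sin theta - g * t) ^ 2).

Lemma continuous_sqrt_sum_sqr (m u : R) :
  continuous (fun x => sqrt (m + x ^ 2)) u.
Proof.
apply continuous_sqrt_comp, (ex_derive_continuous (fun x => m + x ^ 2)).
auto_derive. exact I.
Qed.

Lemma is_derive_sqrt_primitive (m u : R) : 0 < m ->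
  is_derive (fun x => (x * sqrt (m + x ^ 2) + m * ln (x + sqrt (m + x ^ 2))) / 2)
    u (sqrt (m + u ^ 2)).
Proof.
intros hm.
assert (hp : 0 < m + u ^ 2) by nra.
assert (hw := sqrt_lt_R0 _ hp).
assert (hs := sqrt_sqrt (m + u ^ 2) (Rlt_le _ _ hp)).
assert (hpos : 0 < u + sqrt (m + u ^ 2)).
(* For [u <= 0], the argument of [ln] is positive because [sqrt (m + u ^ 2)] exceeds the absolute
   value of [u]. *)
{ destruct (Rlt_le_dec 0 u); [lra|].
  assert (sqrt (u ^ 2) < sqrt (m + u ^ 2)) by (apply sqrt_lt_1; nra).
  replace (u ^ 2) with (Rsqr u) in H at 1 by (unfold Rsqr; ring).
  rewrite sqrt_Rsqr_abs, Rabs_left1 in H; lra. }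
auto_derive; [repeat split; simpl in *; lra|].
replace (u * (u * 1)) with (u ^ 2) by (simpl; ring).
set (w := sqrt (m + u ^ 2)) in *.
(* Eliminating [m] leaves a rational identity in [u] and [w]. *)
replace m with (w * w - u ^ 2) by lra.
field. lra.
Qed.

(** The logarithms stay separate because, when [m + a ^ 2 = v ^ 2] with [v > 0], their difference is
    [2 * artanh (a / v)]. *)
Lemma is_RInt_sqrt_sum_sqr (m a : R) : 0 < m ->
  is_RInt (fun u => sqrt (m + u ^ 2)) (- a) a
    (a * sqrt (m + a ^ 2)
     + m * (ln (sqrt (m + a ^ 2) + a) - ln (sqrt (m + a ^ 2) - a)) / 2).
Proof.
intros hm.
evar_last.
- apply (is_RInt_derive
    (fun x => (x * sqrt (m + x ^ 2) + m * ln (x + sqrt (m + x ^ 2))) / 2)).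
  + intros x _. apply is_derive_sqrt_primitive, hm.
  + intros x _. apply continuous_sqrt_sum_sqr.
- unfold minus, plus, opp. simpl.
  replace ((- a) * ((- a) * 1)) with (a * (a * 1)) by ring.
  rewrite (Rplus_comm a), (Rplus_comm (- a)). unfold Rminus. field.
Qed.

(** The case [m = 0], which is the vertical launch: the integrand is the absolute value, integrated
    separately on each side of 0. *)
Lemma is_RInt_abs (a : R) : 0 <= a -> is_RInt (fun u => sqrt (0 + u ^ 2)) (- a) a (a ^ 2).
Proof.
intros ha.
assert (e : forall u, sqrt (0 + u ^ 2) = Rabs u).
{ intros u. rewrite Rplus_0_l, <- sqrt_Rsqr_abs. f_equal. unfold Rsqr. ring. }
evar_last;
  [apply (is_RInt_Chasles (V := R_NormedModule) _ _ 0 _ (a ^ 2 / 2) (a ^ 2 / 2))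
  | unfold plus; simpl; field].
- apply is_RInt_ext with (fun u => - u).
  { intros u. rewrite Rmin_left, Rmax_right by lra. intros hu.
    rewrite e, Rabs_left; lra. }
  evar_last.
  + apply (is_RInt_derive (fun u => - u ^ 2 / 2)).
    * intros u _. auto_derive; [exact I|field].
    * intros u _. apply (ex_derive_continuous (fun u => - u)).
      auto_derive. exact I.
  + unfold minus, plus, opp. simpl. field.
- apply is_RInt_ext with (fun u => u).
  { intros u. rewrite Rmin_left, Rmax_right by lra. intros hu.
    rewrite e, Rabs_right; lra. }
  evar_last.
  + apply (is_RInt_derive (fun u => u ^ 2 / 2)).
    * intros u _. auto_derive; [exact I|field].
    * intros u _. apply continuous_id.
  + unfold minus, plus, opp. simpl. field.
Qed.

(** Substitution [u = v * sin theta - g * t]. It reverses the interval, and this sign cancels the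
    one in [dt = - du / g]. *)
Lemma is_RInt_speed_subst (v g theta l : R) : 0 < g ->
  is_RInt (fun u => sqrt (v ^ 2 * cos theta ^ 2 + u ^ 2))
    (- (v * sin theta)) (v * sin theta) l ->
  is_RInt (speed v g theta) 0 (tau v g theta) (l / g).
Proof.
intros hg h.
apply is_RInt_swap in h.
assert (h1 := is_RInt_comp_lin (fun u => sqrt (v ^ 2 * cos theta ^ 2 + u ^ 2))
  (- g) (v * sin theta) 0 (tau v g theta) (opp l)).
replace (- g * 0 + v * sin theta) with (v * sin theta) in h1 by ring.
replace (- g * tau v g theta + v * sin theta) with (- (v * sin theta)) in h1
  by (unfold tau; field; lra).
specialize (h1 h).
apply (is_RInt_scal _ _ _ (- / g)) in h1.
change (scal (- / g) (opp l)) with (- / g * - l) in h1.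
replace (- / g * - l) with (l / g) in h1 by (field; lra).
revert h1. apply is_RInt_ext. intros t _.
unfold speed, scal. simpl. unfold mult. simpl.
replace (- g * t + v * sin theta) with (v * sin theta - g * t) by ring.
field. lra.
Qed.

Lemma is_RInt_speed (v g theta : R) : 0 < v -> 0 < g -> 0 <= theta <= PI / 2 ->
  is_RInt (speed v g theta) 0 (tau v g theta) (v ^ 2 / g * F (sin theta)).
Proof.
intros hv hg ht.
assert (hs : 0 <= sin theta) by (apply sin_ge_0; lra).
assert (hsc : cos theta ^ 2 = 1 - sin theta ^ 2)
  by (generalize (sin2_cos2 theta); unfold Rsqr; lra).
destruct (Req_dec (sin theta) 1) as [e|hne].
- replace (v ^ 2 / g * F (sin theta)) with ((v * sin theta) ^ 2 / g)
    by (rewrite e, F_1; field; lra).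
  apply is_RInt_speed_subst; [exact hg|].
  replace (v ^ 2 * cos theta ^ 2) with 0 by (rewrite hsc, e; ring).
  apply is_RInt_abs. nra.
- assert (hs1 : sin theta < 1) by (generalize (SIN_bound theta); lra).
  assert (hm : 0 < v ^ 2 * cos theta ^ 2) by (rewrite hsc; apply Rmult_lt_0_compat; nra).
  assert (h := is_RInt_speed_subst v g theta _ hg
    (is_RInt_sqrt_sum_sqr _ (v * sin theta) hm)).
  (* At launch and landing the speed is [v], so the square root at the endpoints becomes [v]. *)
  replace (v ^ 2 * cos theta ^ 2 + (v * sin theta) ^ 2) with (v ^ 2) in h
    by (rewrite hsc; ring).
  rewrite sqrt_pow2 in h by lra.
  replace (v + v * sin theta) with (v * (1 + sin theta)) in h by ring.
  replace (v - v * sin theta) with (v * (1 - sin theta)) in h by ring.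
  (* Both logarithms contain [ln v], which cancels and leaves [2 * artanh (sin theta)]. *)
  rewrite !ln_mult, hsc in h by lra.
  evar_last; [exact h|]. unfold F, artanh. field. lra.
Qed.

Lemma L_RInt_speed (v g theta : R) :
  L v g theta = RInt (speed v g theta) 0 (tau v g theta).
Proof.
unfold L, arc_length. apply RInt_ext. intros t _. unfold speed. f_equal.
rewrite (is_derive_unique (pos_x v theta) t (v * cos theta))
  by (unfold pos_x; auto_derive; [exact I|ring]).
rewrite (is_derive_unique (pos_y v g theta) t (v * sin theta - g * t))
  by (unfold pos_y; auto_derive; [exact I|field]).
ring.
Qed.

Lemma L_eq_F (v g theta : R) : 0 < v -> 0 < g -> 0 <= theta <= PI / 2 ->
  L v g theta = v ^ 2 / g * F (sin theta).
Proof.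
intros hv hg ht. rewrite L_RInt_speed.
apply is_RInt_unique, is_RInt_speed; assumption.
Qed.

(** * Numerical bounds for [PI] and [sin] *)

Lemma PI_bounds : 3.1412 < PI < 3.1416.
Proof.
(* Partial sums of the alternating series from [PI / 4 = 2 * atan (1/3) + atan (1/7)]. *)
destruct (PI_2_3_7_ineq 2) as [h1 h2].
unfold tg_alt, PI_2_3_7_tg, Ratan_seq in h1, h2. simpl in h1, h2. lra.
Qed.

Lemma sin_lower_bound : sin 0.985503 < 0.833552.
Proof.
(* The upper bound is the Taylor polynomial of degree 9; the lower bound used in the next lemma has
   degree 7. *)
destruct (pre_sin_bound 0.985503 1) as [_ h]; [lra..|].
eapply Rle_lt_trans; [exact h|].
unfold sin_approx, sin_term. cbn [sum_f_R0 Nat.mul Nat.add].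
rewrite !fact_simpl, !mult_INR. simpl. lra.
Qed.

Lemma sin_upper_bound : 0.83357 < sin 0.98555.
Proof.
destruct (pre_sin_bound 0.98555 1) as [h _]; [lra..|].
eapply Rlt_le_trans; [|exact h].
unfold sin_approx, sin_term. cbn [sum_f_R0 Nat.mul Nat.add].
rewrite !fact_simpl, !mult_INR. simpl. lra.
Qed.

(** * Existence and uniqueness of the critical point *)

Lemma mult_artanh_root :
  exists s, 0.833552 < s < 0.83357 /\ s * artanh s = 1.
Proof.
destruct (Ranalysis5.IVT_interv (fun s => s * artanh s - 1) 0.833552 0.83357)
  as [s [hs e]].
- intros a ha. apply derivable_continuous_pt.
  apply ex_derive_Reals_0. unfold artanh. auto_derive. lra.
- lra.
- assert (h := mult_artanh_lower). lra.
- assert (h := mult_artanh_upper). lra.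
- assert (h1 := mult_artanh_lower). assert (h2 := mult_artanh_upper).
  exists s. split; [|lra].
  (* The intermediate value theorem gives a closed interval; the strict signs at the endpoints
     exclude them. *)
  split; apply Rnot_le_lt; intros hle.
  + assert (k : s = 0.833552) by lra. rewrite k in e. lra.
  + assert (k : s = 0.83357) by lra. rewrite k in e. lra.
Qed.

Lemma mult_artanh_eq_1_unique (s t : R) :
  0 < s < 1 -> 0 < t < 1 -> s * artanh s = 1 -> t * artanh t = 1 -> s = t.
Proof.
intros hs ht es et. destruct (Rtotal_order s t) as [h|[h|h]]; [|exact h|].
- assert (k := mult_artanh_lt s t ltac:(lra) h ltac:(lra)). lra.
- assert (k := mult_artanh_lt t s ltac:(lra) h ltac:(lra)). lra.
Qed.

Theorem theorem1 (v g : R) (hv : 0 < v) (hg : 0 < g) :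
  (forall theta : R, 0 <= theta <= PI / 2 ->
     is_RInt (fun t => sqrt (v ^ 2 * cos theta ^ 2 + (v * sin theta - g * t) ^ 2))
       0 (tau v g theta) (L v g theta)) /\
  exists theta_star : R,
    unique (is_maximizer_on (L v g) 0 (PI / 2)) theta_star /\
    (0 < theta_star /\ is_csc_coth_root theta_star /\
       forall theta : R, 0 < theta -> is_csc_coth_root theta -> theta_star <= theta) /\
    (exists alpha : R,
       unique (fun x => 0 < x /\ coth x = x) alpha /\
       1 <= alpha /\ theta_star = arccsc alpha) /\
    0.98545 <= theta_star < 0.98555 /\
    56.465 <= theta_star * 180 / PI < 56.475.
Proof.
split.
(* [RInt] has a value even for a non-integrable function, so integrability is proved along with the
   value. *)
{ intros theta ht. rewrite L_eq_F by assumption.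
  apply is_RInt_speed; assumption. }
destruct mult_artanh_root as [s0 [hs0 e0]].
assert (hpi := PI_bounds).
assert (hsin : sin (asin s0) = s0) by (apply sin_asin; lra).
assert (hb := asin_bound s0).
(* The degree bound fixes this constant: it lies just above [56.465 * 3.1416 / 180]. *)
assert (hlo : 0.985503 < asin s0).
{ apply sin_increasing_0; try lra. rewrite hsin.
  assert (h := sin_lower_bound). lra. }
(* The rounding limit in radians; with [3.1412 < PI] it also gives the limit of 56.475 degrees. *)
assert (hhi : asin s0 < 0.98555).
{ apply sin_increasing_0; try lra. rewrite hsin.
  assert (h := sin_upper_bound). lra. }
assert (hcoth : coth (/ s0) = / s0).
{ apply coth_fixed_artanh; [apply Rinv_0_lt_compat; lra|].
  rewrite Rinv_inv. split; [lra|exact e0]. }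
assert (huniq : forall x, 0 < x -> coth x = x -> x = / s0).
{ intros x hx h. apply coth_fixed_artanh in h as [h1 h2]; [|exact hx].
  assert (h3 := Rinv_0_lt_compat _ hx).
  rewrite (mult_artanh_eq_1_unique s0 (/ x)) by (lra || assumption).
  symmetry. apply Rinv_inv. }
assert (hinv : 1 <= / s0).
{ rewrite <- Rinv_1. apply Rinv_le_contravar; lra. }
assert (hvg : 0 < v ^ 2 / g) by (apply Rdiv_lt_0_compat; [apply pow_lt|]; lra).
assert (hmax : forall y, 0 <= y <= PI / 2 -> y <> asin s0 ->
  L v g y < L v g (asin s0)).
{ intros y hy hne. rewrite !L_eq_F, hsin by (assumption || lra).
  apply Rmult_lt_compat_l; [exact hvg|].
  apply F_lt_max; [lra | exact e0 | split | ].
  - apply sin_ge_0; lra.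
  - apply SIN_bound.
  - intros h. apply hne. rewrite <- h. symmetry. apply asin_sin. lra. }
exists (asin s0). split; [|split; [|split; [|split]]].
- split.
  + split; [lra|]. intros y hy.
    destruct (Req_dec y (asin s0)) as [->|hne]; [lra|].
    left. apply hmax; assumption.
  + intros y [hy hym]. destruct (Req_dec y (asin s0)) as [e|hne]; [easy|].
    assert (k1 := hmax y hy hne).
    assert (k2 := hym (asin s0) ltac:(lra)). lra.
- split; [lra|split].
  + split; rewrite ?hsin; [lra|]. unfold csc. rewrite hsin.
    unfold Rdiv. rewrite Rmult_1_l. easy.
  + intros theta ht [hne hc].
    (* For a root below [asin s0], [sin theta] is positive, so uniqueness of the fixed point forces
       [sin theta = s0]; on this range [asin] then recovers [theta]. *)
    destruct (Rlt_le_dec theta (asin s0)) as [hlt|]; [|assumption].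
    assert (hsp : 0 < sin theta) by (apply sin_gt_0; lra).
    unfold csc, Rdiv in hc. rewrite Rmult_1_l in hc.
    assert (k := huniq (/ sin theta) (Rinv_0_lt_compat _ hsp) (eq_sym hc)).
    apply Rinv_eq_reg in k. rewrite <- k, asin_sin; lra.
- exists (/ s0). split; [|split; [exact hinv|]].
  + split; [split; [lra|exact hcoth]|].
    intros x [hx h]. symmetry. apply huniq; assumption.
  + destruct (arccsc_spec (/ s0) hinv) as [_ hu]. symmetry. apply hu.
    split; [lra|]. unfold csc. rewrite hsin. unfold Rdiv. ring.
- lra.
- split.
  + apply Rmult_le_reg_r with PI; [lra|]. field_simplify; lra.
  + apply Rmult_lt_reg_r with PI; [lra|]. field_simplify; lra.
Qed.
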